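(* Let $G=(V,E)$ be a finite, simple, undirected graph that is $K_{\omega+1}$-free, where $\omega=\omega(G)\ge 2$ is the clique number of $G$. Let $c_{\omega-1}(G)$ be the number of cliques of size $\omega(G)-1$ in $G$ and $c_{\omega}(G)$ the number of cliques of size $\omega(G)$ in $G$. Then $$c_{\omega}(G)\le \frac{1}{\omega(G)-1}\cdot\frac{\big(c_{\omega-1}(G)\big)^2}{4}.$$
   Context: A $k$-clique (clique of size $k$) of $G$ is a complete subgraph of $G$ on $k$ vertices, and $c_k(G)$ denotes the number of $k$-cliques of $G$; in particular $c_1(G)$ is the number of vertices. The clique number $\omega(G)$ is the largest $k$ such that $G$ has a $k$-clique. $G$ is $K_{\omega+1}$-free if it contains no complete subgraph on $\omega+1$ vertices. *)

(* Defs.v *)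
From mathcomp Require Import all_boot all_order all_algebra.

Set Implicit Arguments.
Unset Strict Implicit.
Unset Printing Implicit Defensive.

(* A finite simple undirected graph is a symmetric irreflexive adjacency
   relation on a finType; a complete subgraph is identified with its set of
   vertices. *)
Definition simple_graph (T : finType) (e : rel T) : Prop :=
  symmetric e /\ irreflexive e.

Definition clique (T : finType) (e : rel T) (A : {set T}) : bool :=
  [forall x in A, forall y in A, (x != y) ==> e x y].

Definition kclique (T : finType) (e : rel T) (k : nat) (A : {set T}) : bool :=
  clique e A && (#|A| == k).

Definition num_cliques (T : finType) (e : rel T) (k : nat) : nat :=
  #|[set A : {set T} | kclique e k A]|.

Definition clique_number (T : finType) (e : rel T) : nat :=
  \max_(A : {set T} | clique e A) #|A|.

Definition clique_free (T : finType) (e : rel T) (k : nat) : Prop :=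
  ~ exists A : {set T}, kclique e k A.

(* Main.v *)
Require Import Defs.
From mathcomp Require Import all_boot all_order all_algebra.

(** Put k = omega - 1, and for a k-clique F let d(F) be the number of vertices
    adjacent to all of F, that is, the number of (k+1)-cliques containing F.
    The proof is the degree argument for Mantel's theorem, run on the graph
    whose points are the k-cliques, and it gives the stronger bound
    (k+1)^2 c_(k+1) <= c_k^2.

    Counting pairs (K, v) with v in the (k+1)-clique K by the facet K - v
    ([sum_facets]) gives both
      sum_F d(F) = (k+1) c_(k+1)   and
      sum_F d(F)^2 = sum_K sum_(v in K) d(K - v).
    The inner sum on the right is at most c_k ([sum_codegree_facets]): a vertex
    adjacent to a facet of K, but not to all of K, produces its own k-clique,
    and no vertex is adjacent to all of K because there is no (k+2)-clique.
    Cauchy-Schwarz then yields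
      ((k+1) c_(k+1))^2 <= c_k sum_F d(F)^2 <= c_k^2 c_(k+1),
    and c_(k+1) cancels. The constant 4 (omega - 1) of the theorem follows
    since 4 (omega - 1) <= omega^2. *)

Import Order.TTheory GRing.Theory Num.Theory.

Set Implicit Arguments.
Unset Strict Implicit.
Unset Printing Implicit Defensive.

Local Open Scope nat_scope.

(** Cauchy-Schwarz against the constant 1: sum [2 x y <= x^2 + y^2] over all
    pairs of terms. *)
Lemma sum_sqr_le_card (I : finType) (P : pred I) (d : I -> nat) :
  (\sum_(i | P i) d i) ^ 2 <= #|P| * \sum_(i | P i) d i ^ 2.
Proof.
rewrite -(leq_pmul2l (isT : 0 < 2)).
have -> : 2 * (\sum_(i | P i) d i) ^ 2
    = \sum_(i | P i) \sum_(j | P j) 2 * (d i * d j).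
  rewrite -mulnn big_distrlr big_distrr; apply: eq_bigr => i _ /=.
  by rewrite big_distrr.
have -> : 2 * (#|P| * \sum_(i | P i) d i ^ 2)
    = \sum_(i | P i) \sum_(j | P j) (d i ^ 2 + d j ^ 2).
  under [RHS]eq_bigr => i _ do rewrite big_split /= sum_nat_const.
  by rewrite big_split /= sum_nat_const -big_distrr /= mul2n addnn.
by apply: leq_sum => i _; apply: leq_sum => j _; apply: nat_Cauchy.
Qed.

Section Cliques.

Variables (T : finType) (e : rel T).
Hypothesis graph_e : simple_graph e.

Definition common_nbhd (A : {set T}) : {set T} :=
  [set v | [forall u in A, e v u]].

Lemma common_nbhdP (A : {set T}) v :
  reflect {in A, forall u, e v u} (v \in common_nbhd A).
Proof. by rewrite inE; apply: forall_inP. Qed.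

Lemma cliqueP (A : {set T}) :
  reflect {in A &, forall x y, x != y -> e x y} (clique e A).
Proof.
apply: (iffP forall_inP) => [cA x y Ax Ay | cA x Ax].
  by have /forall_inP/(_ y Ay)/implyP := cA x Ax.
by apply/forall_inP => y Ay; apply/implyP; apply: cA.
Qed.

Lemma clique_subset (A B : {set T}) : A \subset B -> clique e B -> clique e A.
Proof.
by move=> /subsetP sAB /cliqueP cB; apply/cliqueP => x y /sAB Bx /sAB By; apply: cB.
Qed.

Lemma notin_common_nbhd (A : {set T}) v : v \in common_nbhd A -> v \notin A.
Proof.
by move=> /common_nbhdP nAv; apply/negP => /nAv; rewrite graph_e.2.
Qed.

Lemma clique_setU1 (A : {set T}) v :
  v \notin A -> clique e (v |: A) = clique e A && (v \in common_nbhd A).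
Proof.
move=> Av; apply/idP/andP => [cvA | [/cliqueP cA /common_nbhdP nAv]].
  split; first by apply: clique_subset cvA; apply: subsetUr.
  apply/common_nbhdP => u Au; move/cliqueP: cvA; apply.
  - exact: setU11.
  - exact: setU1r.
  - by apply: contraNneq Av => ->.
apply/cliqueP => x y /setU1P[-> | Ax] /setU1P[-> | Ay]; rewrite ?eqxx // => xy.
- exact: nAv.
- by rewrite graph_e.1; apply: nAv.
- exact: cA.
Qed.

Lemma kclique_setU1 k (A : {set T}) v :
  v \notin A ->
  kclique e k.+1 (v |: A) = kclique e k A && (v \in common_nbhd A).
Proof.
by move=> Av; rewrite /kclique clique_setU1 // cardsU1 Av add1n eqSS andbAC.
Qed.

Lemma kclique_facet k (K : {set T}) u : kclique e k.+1 K -> u \in K ->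
  kclique e k (K :\ u).
Proof.
move=> kK Ku; have := @kclique_setU1 k (K :\ u) u.
by rewrite setD11 setD1K // kK => /(_ isT)/esym/andP[].
Qed.

Lemma num_cliquesE k : num_cliques e k = #|kclique e k|.
Proof. by rewrite /num_cliques cardsE. Qed.

(** A clique with a distinguished vertex is the same as a facet together with
    a common neighbour of that facet. *)
Lemma sum_facets k (f : {set T} -> nat) :
  \sum_(K | kclique e k.+1 K) \sum_(v in K) f (K :\ v)
    = \sum_(F | kclique e k F) #|common_nbhd F| * f F.
Proof.
under [RHS]eq_bigr => F _ do rewrite -sum_nat_const.
rewrite !pair_big_dep /=.
rewrite (reindex_onto (fun p : {set T} * T => (p.2 |: p.1, p.2))
                      (fun p => (p.1 :\ p.2, p.2))) /=; last first.
  by move=> [K v] /= /andP[_ Kv]; rewrite setD1K.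
have setU1D1 (F : {set T}) v : ((v |: F) :\ v == F) = (v \notin F).
  apply/eqP/idP => [<- | Fv]; first by rewrite setD11.
  exact: setU1K.
apply: eq_big => [[F v] | [F v]] /=.
  rewrite setU11 andbT xpair_eqE eqxx andbT setU1D1.
  have [Fv | Fv] := boolP (v \in F); last by rewrite andbT kclique_setU1.
  rewrite andbF; apply/esym/negbTE; rewrite negb_and; apply/orP; right.
  by apply: contraTN Fv => /notin_common_nbhd.
by case/andP=> _; rewrite xpair_eqE => /andP[/eqP-> _].
Qed.

(** Since no vertex is adjacent to all of K, a vertex [v] outside K is adjacent
    to at most one facet [K :\ u], so the pairs [(u, v)] counted here with [v]
    outside K are determined by [v]; those with [v] in K have [v = u].
    Attach to the former the clique obtained from the facet by exchanging some
    vertex for [v], and to the latter the facet [K :\ u] itself. The attached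
    k-cliques are distinct: each of the first kind meets the complement of K
    exactly in [v]. *)
Lemma sum_codegree_facets k (K : {set T}) :
  0 < k -> clique_free e k.+2 -> kclique e k.+1 K ->
  \sum_(u in K) #|common_nbhd (K :\ u)| <= num_cliques e k.
Proof.
move=> k_gt0 free_e kK.
have noK v : v \notin common_nbhd K.
  apply/negP => nKv; apply: free_e; exists (v |: K).
  by rewrite kclique_setU1 ?kK // notin_common_nbhd.
have inK u v : v \in common_nbhd (K :\ u) -> v \in K -> v = u.
  by move=> /notin_common_nbhd; rewrite !inE => + Kv; rewrite Kv andbT negbK => /eqP.
pose x u := odflt u [pick y in K :\ u].
have xP u : u \in K -> x u \in K :\ u.
  move=> Ku; rewrite /x; case: pickP => //= K0; have := kclique_facet kK Ku.
  by rewrite /kclique (eq_card0 K0) (ltn_eqF k_gt0) andbF.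
pose S := [set p : T * T | (p.1 \in K) && (p.2 \in common_nbhd (K :\ p.1))].
pose g (p : T * T) :=
  if p.2 \in K then K :\ p.1 else p.2 |: (K :\ p.1 :\ x p.1).
have -> : \sum_(u in K) #|common_nbhd (K :\ u)| = #|S|.
  under eq_bigr => u _ do rewrite -sum1_card.
  rewrite pair_big_dep /= -sum1_card.
  by apply: eq_bigl => p; rewrite [RHS]inE.
have out p q : g p = g q -> p.2 \notin K -> p.2 = q.2.
  move=> gpq Kp; have : p.2 \in g q by rewrite -gpq /g (negbTE Kp) setU11.
  by rewrite /g; case: ifP; rewrite !inE (negbTE Kp) ?andbF ?orbF // => _ /eqP.
rewrite -(@card_in_imset _ _ g S).
  rewrite num_cliquesE; apply: subset_leq_card; apply/subsetP => G /imsetP[[u v]].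
  rewrite inE /= => /andP[Ku nuv] {G}->.
  change (is_true (kclique e k (g (u, v)))); rewrite /g /=.
  have kF := kclique_facet kK Ku.
  case: ifP => // /negbT Kv.
  move: k_gt0 kF; case: (k) => // k' _ kF.
  rewrite kclique_setU1 ?inE ?(negbTE Kv) ?andbF // (kclique_facet kF (xP u Ku)) /=.
  apply/forall_inP => y; rewrite inE => /andP[_ Fy].
  by move/common_nbhdP: nuv; apply.
move=> [u v] [u' v']; rewrite ![_ \in S]inE /= => /andP[Ku nuv] /andP[Ku' nuv'] gE.
have [Kv | Kv] := boolP (v \in K); last first.
  have vv' := out _ _ gE Kv; rewrite /= in vv'.
  rewrite -vv' in nuv' *; case: (eqVneq u u') => [-> // | uu'].
  case/negP: (noK v); apply/common_nbhdP => y Ky.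
  case: (eqVneq y u) => [yu | yu]; last first.
    by move/common_nbhdP: nuv; apply; rewrite !inE yu.
  by move/common_nbhdP: nuv'; apply; rewrite !inE Ky yu uu'.
have Kv' : v' \in K.
  apply/negPn/negP => Kv'.
  by have /= v'v := out _ _ (esym gE) Kv'; rewrite v'v Kv in Kv'.
have -> := inK _ _ nuv Kv; have -> := inK _ _ nuv' Kv'.
suff -> : u = u' by [].
move: gE; rewrite /g /= Kv Kv' => /setP/(_ u).
by rewrite !inE eqxx Ku !andbT => /esym/negbFE/eqP.
Qed.

Theorem num_cliques_succ_le k :
  0 < k -> clique_free e k.+2 ->
  k.+1 ^ 2 * num_cliques e k.+1 <= num_cliques e k ^ 2.
Proof.
move=> k_gt0 free_e; set N := num_cliques e k; set c := num_cliques e k.+1.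
have [-> | c_gt0] := posnP c; first by rewrite muln0.
have sum_codegree :
    k.+1 * c = \sum_(F | kclique e k F) #|common_nbhd F|.
  transitivity (\sum_(K | kclique e k.+1 K) \sum_(v in K) 1).
    under eq_bigr => K /andP[_ /eqP cardK] do rewrite sum1_card cardK.
    by rewrite sum_nat_const /c num_cliquesE mulnC.
  rewrite (sum_facets k (fun=> 1)).
  by apply: eq_bigr => F _; rewrite muln1.
have sum_codegree2 :
    \sum_(F | kclique e k F) #|common_nbhd F| ^ 2 <= c * N.
  under eq_bigr => F _ do rewrite -mulnn.
  rewrite -(sum_facets k (fun F => #|common_nbhd F|)).
  rewrite /c num_cliquesE -sum_nat_const.
  by apply: leq_sum => K; apply: sum_codegree_facets.
rewrite -(leq_pmul2r c_gt0) -mulnA mulnn -expnMn sum_codegree.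
apply: leq_trans (sum_sqr_le_card _ _) _.
by rewrite -num_cliquesE -/N -mulnn -mulnA leq_mul2l [N * c]mulnC sum_codegree2 orbT.
Qed.

End Cliques.

Local Open Scope ring_scope.

Theorem theorem3p4 (T : finType) (e : rel T)
  (graph_e : simple_graph e)
  (omega_ge2 : (2 <= clique_number e)%N)
  (free_e : clique_free e (clique_number e).+1) :
  (num_cliques e (clique_number e))%:R
    <= 1 / ((clique_number e)%:R - 1)
       * ((num_cliques e (clique_number e - 1))%:R ^+ 2 / 4) :> rat.
Proof.
move: omega_ge2 free_e; case: (clique_number e) => [|k] //.
rewrite ltnS subn1 /= => k_gt0 free_e.
have := num_cliques_succ_le graph_e k_gt0 free_e.
set c := num_cliques e k.+1; set N := num_cliques e k => le_cN.
have {le_cN} le_cN : (4 * k * c <= N ^ 2)%N.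
  apply: leq_trans le_cN; rewrite leq_mul2r; apply/orP; right.
  by have := (nat_AGM2 k 1).1; rewrite muln1 addn1.
rewrite -[k.+1]addn1 natrD addrK mulrA mul1r ler_pdivlMr // mulrC.
rewrite ler_pdivlMl ?ltr0n // -natrX -!natrM ler_nat.
by rewrite mulnCA mulnA.
Qed.
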